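(* Let $n\ge 2$, let $\mathbf m\colon[n]\to[n]$ be a Hessenberg function, and let $(a,b)$ be a partition of $n$ of length $2$ (so $a\ge b\ge1$, $a+b=n$). Then the coefficient of $e_{a,b}=e_ae_b$ in the expansion of the chromatic symmetric function $\mathrm{csf}(\mathbf m;x)$ in the basis $(e_\lambda)$ of elementary symmetric functions is non-negative.
   Context: $[n]=\{1,\dots,n\}$. A Hessenberg function is a non-decreasing $\mathbf m\colon[n]\to[n]$ with $\mathbf m(i)\ge i$ for all $i$. $G_{\mathbf m}$ is the graph with vertex set $[n]$ and edges $\{i,j\}$ for $i<j\le\mathbf m(i)$. $\mathrm{csf}(\mathbf m;x)=\sum_\kappa\prod_{v\in[n]}x_{\kappa(v)}$, the sum over all proper colorings $\kappa\colon[n]\to\mathbb{N}$ of $G_{\mathbf m}$ (adjacent vertices receive different colors). $e_j$ is the elementary symmetric function and $e_\lambda=\prod_ie_{\lambda_i}$. *)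

(* Defs.v *)
From HB Require Import structures.
From mathcomp Require Import all_boot all_order all_algebra.
From mathcomp.multinomials Require Import mpoly.

Set Implicit Arguments.
Unset Strict Implicit.
Unset Printing Implicit Defensive.

Import Order.TTheory GRing.Theory Num.Theory.
Local Open Scope ring_scope.

(* The vertex set [n] = {1, ..., n} is 'I_n = {0, ..., n-1}; shifting both the
   arguments and the values by one changes none of the conditions below. *)
Definition hessenberg (n : nat) (m : 'I_n -> 'I_n) : Prop :=
  (forall i j : 'I_n, (i <= j)%N -> (m i <= m j)%N) /\
  (forall i : 'I_n, (i <= m i)%N).

Definition hess_adj (n : nat) (m : 'I_n -> 'I_n) : rel 'I_n :=
  fun i j => (i < j <= m i)%N || (j < i <= m j)%N.

Definition proper_coloring (n : nat) (m : 'I_n -> 'I_n) (C : eqType)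
    (kappa : 'I_n -> C) : bool :=
  [forall i, forall j, hess_adj m i j ==> (kappa i != kappa j)].

(* Symmetric functions in x_0, x_1, ... over int are taken as elements of the
   inverse limit of the rings of symmetric polynomials in k variables: such an
   f is given by the polynomials f k = f(x_0, ..., x_(k-1), 0, 0, ...) for all
   k.  Since every monomial involves finitely many variables, two of them are
   equal as power series iff they agree for every k. *)
Definition symfun : Type := forall k : nat, {mpoly int[k]}.

(* Setting x_i = 0 for i >= k in the sum over colorings by nat leaves exactly
   the colorings with all colors < k. *)
Definition csf (n : nat) (m : 'I_n -> 'I_n) : symfun := fun k =>
  \sum_(kappa : {ffun 'I_n -> 'I_k} | proper_coloring m kappa)
     \prod_(v < n) 'X_(kappa v).

Definition elem_prod (la : seq nat) : symfun := fun k =>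
  \prod_(j <- la) @mesym k int j.

Definition is_partition (n : nat) (la : seq nat) : bool :=
  [&& sorted geq la, 0%N \notin la & sumn la == n].

(* A partition of n has at most n parts, each at most n. *)
Definition partitions (n : nat) : seq (seq nat) :=
  [seq la <- [seq [seq val i | i <- s] | s : n.-bseq 'I_n.+1]
     | is_partition n la].

Lemma partitions_uniq n : uniq (partitions n).
Proof.
apply/filter_uniq; rewrite map_inj_uniq ?enum_uniq // => s t /inj_map st.
by apply/val_inj/st/val_inj.
Qed.

Lemma mem_partitions n la : (la \in partitions n) = is_partition n la.
Proof.
rewrite mem_filter andb_idr // => /and3P[_ la0 /eqP sum_la].
have size_la : (size la <= n)%N.
  rewrite -sum_la; elim: la la0 {sum_la} => //= x s IHs.
  rewrite inE negb_or eq_sym -lt0n => /andP[x0 /IHs le_s].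
  by rewrite -add1n leq_add.
have le_la x : x \in la -> (x < n.+1)%N.
  by rewrite ltnS -sum_la => /perm_to_rem/perm_sumn ->; apply: leq_addr.
have size_s : (size [seq (inord x : 'I_n.+1) | x <- la] <= n)%N.
  by rewrite size_map.
apply/imageP; exists (Bseq size_s) => //=.
by rewrite -map_comp map_id_in // => x /le_la xn /=; rewrite inordK.
Qed.

(* f = sum of c la * e_la over the partitions la of n; since the e_la form a
   basis, this determines c on the partitions of n. *)
Definition e_expansion (n : nat) (f : symfun) (c : seq nat -> int) : Prop :=
  forall k : nat, f k = \sum_(la <- partitions n) c la *: elem_prod la k.

(* Main.v *)
(** Call a map w from positions to vertices s-admissible when w (s i) <= m (w i)
for all positions i, and write s for the n-cycle i -> i+1 and s' for the
permutation with cycles (0 ... a-1) and (a ... n-1).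

A signed count of the colorings fixed by a permutation is a determinant, which
gives csf = sum of sgn t * p_(cycle type of t) over the permutations t with
t i <= m i.  By Newton's identities and the algebraic independence of the e_j,
the coefficient of e_a e_b only sees the t with one or two cycles, and it is
(up to a factor 2 if a = b) the number of s'-admissible permutations w minus
the number of s-admissible ones.

This difference is nonnegative because w |-> w s^-k s'^k, with k >= 0 minimal
such that w s^-k is s'-admissible, injects the s-admissible permutations into
the s'-admissible ones: k is recovered from the image w' as the least k such
that w' s'^-k is s-admissible. *)
Require Import Defs.
From mathcomp Require Import all_boot all_order all_algebra.
From mathcomp Require Import all_fingroup zify ring.
From mathcomp.multinomials Require Import mpoly.

Set Implicit Arguments.
Unset Strict Implicit.
Unset Printing Implicit Defensive.

Import Order.TTheory GRing.Theory Num.Theory.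

(** * Cutting an admissible cyclic word in two *)

Section CyclicWords.

Local Open Scope group_scope.

Section Injection.

Variables (N : nat) (m : 'I_N -> 'I_N).
Hypothesis m_mono : forall i j : 'I_N, i <= j -> m i <= m j.

Lemma ltn_of_ltn_m (u v : 'I_N) : m u < m v -> u < v.
Proof. by apply: contraTltn => /m_mono; rewrite -leqNgt. Qed.

(* G reads a word along the n-cycle s from x, and U, V read it along the two
   cycles of cut s x y below, from x and from y. *)
Lemma periodic_run (G U V : nat -> 'I_N) (a b k : nat) :
    0 < a -> 0 < b ->
    (forall i, G i.+1 <= m (G i)) -> (forall i, G (i + (a + b)) = G i) ->
    (forall i, U (i + a) = U i) -> (forall i, i < a -> U i = G i) ->
    (forall i, V (i + b) = V i) -> (forall i, i < b -> V i = G (a + i)) ->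
    (forall j, j < k -> m (G (a + j)) < G j.+1) ->
  forall j, j < k -> m (V j) < U j.+1.
Proof.
move=> a_gt0 b_gt0 G_adm G_per U_per UG V_per VG run j lt_jk.
(* During the run [G] drops over distance [a], so continuing periodically with [U] only raises its
   values, and with [V] only lowers them. *)
have G_lt i : i <= k -> G (a + i) < G i.
  case: i => [|i] lt_ik.
    rewrite addn0; apply: ltn_of_ltn_m; apply: leq_trans (G_adm 0).
    by have := run 0 (leq_ltn_trans (leq0n j) lt_jk); rewrite addn0.
  by rewrite addnS; apply: leq_ltn_trans (G_adm _) (run _ lt_ik).
have leGU i : i <= k -> G i <= U i.
  elim/ltn_ind: i => i IHi le_ik; have [/UG->//|le_ai] := ltnP i a.
  rewrite -(subnKC le_ai) [X in _ <= nat_of_ord (U X)]addnC U_per.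
  by apply: ltnW (leq_trans (G_lt _ _) (IHi _ _ _)); lia.
have leVG i : i <= k -> V i <= G (a + i).
  elim/ltn_ind: i => i IHi le_ik; have [/VG->//|le_bi] := ltnP i b.
  rewrite -(subnK le_bi) V_per addnA [(a + _)%N]addnC -addnA G_per.
  by apply: ltnW (leq_ltn_trans (IHi _ _ _) (G_lt _ _)); lia.
apply: leq_ltn_trans (m_mono (leVG _ (ltnW lt_jk))) _.
exact: leq_trans (run _ lt_jk) (leGU _ lt_jk).
Qed.

Variable T : finType.
Implicit Types (s : {perm T}) (f : T -> 'I_N).

Definition adm s f := [forall i, f (s i) <= m (f i)].

Lemma admP s f : reflect (forall i, f (s i) <= m (f i)) (adm s f).
Proof. exact: forallP. Qed.

Lemma adm_pow s f k : adm s f -> adm s (f \o (s ^+ k)).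
Proof.
by move=> /admP sf; apply/admP => i /=; rewrite -permM -expgS expgSr permM.
Qed.

(* If x and y lie on one cycle of s, it is split into two cycles, one running
   from x to the predecessor of y and the other from y to that of x. *)
Definition cut s (x y : T) : {perm T} := tperm (s^-1 x) (s^-1 y) * s.

Lemma cutC s x y : cut s x y = cut s y x.
Proof. by rewrite /cut tpermC. Qed.

Lemma cutl s x y : cut s x y (s^-1 x) = y.
Proof. by rewrite permM tpermL permKV. Qed.

Lemma cutr s x y : cut s x y (s^-1 y) = x.
Proof. by rewrite permM tpermR permKV. Qed.

(** Failure at the step from [s^-1 y] to [x], one of the two steps where [cut s x y] may differ from
    [s]. *)
Definition bad s x y f := m (f (s^-1 y)) < f x.

Lemma adm_cut s x y f :
  adm s f -> adm (cut s x y) f = ~~ bad s x y f && ~~ bad s y x f.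
Proof.
move=> /admP sf; rewrite -!leqNgt; apply/admP/andP => [cf|[fx fy] i].
  by have := cf (s^-1 x); have := cf (s^-1 y); rewrite cutl cutr.
by rewrite permM; case: tpermP => [->|->|_ _]; rewrite ?permKV.
Qed.

(** Failure into [x] gives [f y < f x], so [f (s y) <= m (f y) <= m (f x)]: the other junction
    cannot fail one rotation later. *)
Lemma bad_switch s x y f :
  adm s f -> bad s x y f -> ~~ bad s y x (f \o s).
Proof.
move=> /admP sf; rewrite /bad -leqNgt /= permKV => bad_f.
have lt_yx : f y < f x.
  by apply: leq_ltn_trans bad_f; have := sf (s^-1 y); rewrite permKV.
exact: leq_trans (sf _) (m_mono (ltnW lt_yx)).
Qed.

Lemma adm_comp s f : adm s f -> adm s (f \o s).
Proof. exact: (@adm_pow s f 1). Qed.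

(** By [bad_switch], the failing junction stays the same throughout a run of inadmissible
    rotations. *)
Lemma bad_run s x y f k : adm s f ->
    (forall i, i <= k -> ~~ adm (cut s x y) (f \o s ^+ i)) ->
    bad s x y f ->
  forall i, i <= k -> bad s x y (f \o s ^+ i).
Proof.
move=> sf cutN f_bad; elim=> [|i IHi] le_ik.
  by rewrite expg0 /bad /= !perm1.
have /cutN := le_ik; rewrite adm_cut ?adm_pow // negb_and !negbK.
case/orP=> // byx; have := bad_switch (adm_pow i sf) (IHi (ltnW le_ik)).
suff -> : bad s y x ((f \o s ^+ i) \o s) = bad s y x (f \o s ^+ i.+1).
  by rewrite byx.
by rewrite /bad /= -!permM -expgS.
Qed.

Definition splits s (x y : T) (a : nat) :=
  [/\ 0 < a, (s ^+ a) x = y,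
      forall i, i < a -> (cut s x y ^+ i) x = (s ^+ i) x
    & (cut s x y ^+ a) x = x].

(** [periodic_run] turns failures of the cut along [s] into failures of [s] along the cut, all at
    the step from [s^-1 x] to [x]. *)
Lemma bad_not_adm_cutX s x y a b f k :
    splits s x y a -> splits s y x b -> adm s f ->
    (forall i, 0 < i <= k -> bad s x y (f \o s ^+ i)) ->
  forall i, 0 < i <= k -> ~~ adm s (f \o cut s x y ^+ i).
Proof.
move=> [a_gt0 sax cx cax] [b_gt0 sby cy cby] sf f_bad [//|j] /= le_jk.
rewrite cutC in cy cby.
pose G i := f ((s ^+ i) x).
pose U i := f ((cut s x y ^+ i) x); pose V i := f ((cut s x y ^+ i) y).
have VG i : i < b -> V i = G (a + i).
  by move=> /cy; rewrite /G /V expgD permM sax => ->.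
suff lt_VU : m (V j) < U j.+1.
  apply/admP => /(_ (s^-1 x)) /=; rewrite permKV leqNgt.
  by rewrite [X in m (f (fun_of_perm X _))]expgS permM cutl lt_VU.
apply: (@periodic_run G U V a b k) => //.
- by move=> i; rewrite /G expgSr permM; apply/admP/sf.
- by move=> i; rewrite /G addnC !expgD !permM sax sby.
- by move=> i; rewrite /U addnC expgD permM cax.
- by move=> i /cx; rewrite /G /U => ->.
- by move=> i; rewrite /V addnC expgD permM cby.
move=> i lt_ik; have /f_bad := (lt_ik : 0 < i.+1 <= k).
rewrite /bad /= {1}expgS permM permKV /G expgD permM sax; exact.
Qed.

(** This makes the exponent of the injection recoverable. Exponents start at 1 because [f] itself
    will be admissible for both permutations. *)
Lemma not_adm_cutX s x y a b f k :
    splits s x y a -> splits s y x b -> adm s f ->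
    (forall i, 0 < i <= k -> ~~ adm (cut s x y) (f \o s ^+ i)) ->
  forall i, 0 < i <= k -> ~~ adm s (f \o cut s x y ^+ i).
Proof.
move=> sx sy sf; case: k => [|k] cutN; first by case.
have bad_from u v : cut s u v = cut s x y -> bad s u v (f \o s) ->
    forall i, 0 < i <= k.+1 -> bad s u v (f \o s ^+ i).
  move=> cut_uv bad_f [//|i] /andP[_ le_ik].
  have comp_pow j : (f \o s) \o s ^+ j =1 f \o s ^+ j.+1.
    by move=> z /=; rewrite -permM -expgSr.
  have := bad_run (k := k) (adm_comp sf) _ bad_f le_ik.
  rewrite /bad !comp_pow; apply=> j le_jk.
  have := cutN j.+1 le_jk; rewrite cut_uv /adm.
  by under eq_forallb do rewrite -!comp_pow.
have := cutN 1%N isT; rewrite expg1 adm_cut ?adm_comp // negb_and !negbK.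
case/orP=> [/bad_from|/bad_from].
  by move=> /(_ erefl); apply: bad_not_adm_cutX sx sy sf.
rewrite cutC => /(_ erefl) bad_f i le_i; rewrite cutC.
exact: bad_not_adm_cutX sy sx sf bad_f _ le_i.
Qed.

(** [G] would decrease strictly along steps of length [a] forever, which is impossible below [N]. *)
Lemma not_always_bad s x y a f :
    splits s x y a -> adm s f -> ~ forall i, bad s x y (f \o s ^+ i).
Proof.
move=> [a_gt0 sax _ _] /admP sf f_bad.
pose G i := f ((s ^+ i) x).
have G_lt i : G (i.+1 + a) < G i.+1.
  have := f_bad i.+1; rewrite /bad /= {1}expgS permM permKV.
  apply: leq_ltn_trans; rewrite /G addSn addnC expgSr permM.
  by rewrite expgD permM sax; apply: sf.
have G_dec i : G (i * a).+1 + i <= G 1%N.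
  elim: i => [|i]; first by rewrite addn0.
  apply: leq_trans.
  by rewrite addnS -addSn leq_add2r mulSn [(a + _)%N]addnC G_lt.
by have := leq_trans (leq_addl _ _) (G_dec N); rewrite leqNgt ltn_ord.
Qed.

Lemma ex_adm_cut s x y a b f :
    splits s x y a -> splits s y x b -> adm s f ->
  exists k, adm (cut s x y) (f \o s ^+ k).
Proof.
move=> sx sy sf.
(* The powers of [s] are finitely many, so the existence of [k] can be decided. *)
have [/existsP[k ak]|] :=
    boolP [exists k : 'I_#[s], adm (cut s x y) (f \o s ^+ k)].
  by exists k.
rewrite negb_exists => /forallP cutN; exfalso.
have {}cutN i : ~~ adm (cut s x y) (f \o s ^+ i).
  have := cutN (Ordinal (ltn_pmod i (order_gt0 s))) => /=.
  by rewrite expg_mod_order.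
have := cutN 0; rewrite expg0 adm_cut; last first.
  by move/admP: sf => sf; apply/admP => i /=; rewrite !perm1.
have f1 : f \o (1 : {perm T}) =1 f by move=> i; rewrite /= perm1.
rewrite negb_and !negbK => /orP[]; rewrite /bad !f1 => f_bad.
  apply: (not_always_bad sx sf) => i.
  exact: (bad_run sf _ f_bad (leqnn i)).
apply: (not_always_bad sy sf) => i.
by apply: (bad_run sf _ f_bad (leqnn i)) => j _; rewrite cutC.
Qed.

End Injection.

Theorem card_adm_le_cut N (m : 'I_N -> 'I_N) (s : {perm 'I_N}) x y a b :
    (forall i j : 'I_N, i <= j -> m i <= m j) ->
    splits s x y a -> splits s y x b ->
  #|[set w : {perm 'I_N} | adm m s w]| <=
  #|[set w : {perm 'I_N} | adm m (cut s x y) w]|.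
Proof.
move=> m_mono sx sy; set c := cut s x y; pose t := s^-1.
have eq_adm u (f g : 'I_N -> 'I_N) (fg : f =1 g) : adm m u f = adm m u g.
  by rewrite /adm; under eq_forallb do rewrite !fg.
have adm_t (w : {perm 'I_N}) i : adm m s w -> adm m s (t ^+ i * w).
  move=> sw; rewrite -(eq_adm s (w \o s ^+ (i * #[s].-1))) ?adm_pow // => z.
  by rewrite mulnC expgM -invg_expg permM.
have ex_k (w : {perm 'I_N}) : adm m s w -> exists k, adm m c (t ^+ k * w).
  case/(ex_adm_cut m_mono sx sy) => k ak; exists (#[t].-1 * k)%N.
  rewrite expgM -invg_expg invgK.
  by rewrite -(eq_adm _ _ _ (permM (s ^+ k) w)) in ak.
(* Products of permutations act from left to right, so [t ^+ k * w] is w s^-k. The exponent defaults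
   to 0 for inadmissible [w]. *)
have pick_k (w : {perm 'I_N}) : {k | adm m s w ->
    adm m c (t ^+ k * w) /\ forall j, j < k -> ~~ adm m c (t ^+ j * w)}.
  have [sw|] := boolP (adm m s w); last by exists 0.
  have [k ak min_k] := ex_minnP (ex_k w sw); exists k => _; split=> // j.
  by rewrite ltnNge; apply: contra => /min_k.
pose k w := sval (pick_k w).
pose phi w := c ^+ k w * (t ^+ k w * w).
have phiN (w : {perm 'I_N}) i : adm m s w -> 0 < i <= k w ->
    ~~ adm m s (c ^+ i * (t ^+ k w * w)).
  move=> sw le_i; have [ck minck] := svalP (pick_k w) sw.
  have := not_adm_cutX (k := k w) m_mono sx sy (adm_t _ (k w) sw) _ le_i.
  rewrite (eq_adm _ _ _ (permM (c ^+ i) _)); apply=> j /andP[j_gt0 le_j].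
  rewrite -/c -(eq_adm _ _ _ (permM (s ^+ j) _)) mulgA.
  rewrite -(subnKC le_j) expgD mulgA expgVn mulgV mul1g.
  by apply: minck; rewrite -/(k w); lia.
have phi_inj (w1 w2 : {perm 'I_N}) : adm m s w1 -> adm m s w2 -> k w1 <= k w2 ->
    phi w1 = phi w2 -> w1 = w2.
  move=> sw1 sw2; rewrite leq_eqVlt => /orP[/eqP eqk | lt_k].
    by rewrite /phi eqk => /mulgI/mulgI.
  (* Cancelling [c ^+ k w1] makes [c ^+ (k w2 - k w1) * (t ^+ k w2 * w2)] equal to the
     [s]-admissible [t ^+ k w1 * w1], against [phiN]. *)
  rewrite /phi -{1}(subnKC (ltnW lt_k)) expgD -mulgA => /mulgI eq_phi.
  have /negP[] := @phiN w2 (k w2 - k w1)%N sw2 ltac:(lia).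
  by rewrite -eq_phi adm_t.
rewrite -(card_in_imset (f := phi)); last first.
  move=> w1 w2; rewrite !inE => sw1 sw2 eq_phi.
  have [le_k|/ltnW le_k] := leqP (k w1) (k w2); first exact: phi_inj.
  exact/esym/phi_inj.
apply/subset_leq_card/subsetP => _ /imsetP[w + ->]; rewrite !inE => sw.
have [ck _] := svalP (pick_k w) sw.
by have := adm_pow (k w) ck; rewrite -(eq_adm _ _ _ (permM (c ^+ k w) _)).
Qed.

(** [s] and its cut differ at most at the predecessors of [x] and [y], so their paths from [x] agree
    until [x] or [y] is reached. *)
Lemma splits_avoid (T : finType) (s : {perm T}) x y a :
    0 < a -> (s ^+ a) x = y ->
    (forall i, 0 < i < a -> ((s ^+ i) x != x) && ((s ^+ i) x != y)) ->
  splits s x y a.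
Proof.
move=> a_gt0 sax avoid.
have cut_pow i : i < a -> (cut s x y ^+ i) x = (s ^+ i) x.
  elim: i => [|i IHi] lt_ia; first by rewrite !expg0.
  rewrite expgSr permM IHi ?(ltnW lt_ia) // expgSr !permM.
  have /avoid := (lt_ia : 0 < i.+1 < a); rewrite expgSr permM => /andP[Nx Ny].
  by rewrite tpermD // -(inj_eq (@perm_inj _ s)) permKV eq_sym.
split=> //; move: a_gt0 sax cut_pow; case: (a) => // k _ sax cut_pow.
rewrite expgSr permM cut_pow //.
have -> : (s ^+ k) x = s^-1 y by rewrite -sax expgSr permM permK.
exact: cutr.
Qed.

Lemma porbit_period (T : finType) (s : {perm T}) (x z : T) a :
    0 < a -> (s ^+ a) x = x -> z \in porbit s x ->
  exists2 i, i < a & z = (s ^+ i) x.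
Proof.
move=> a_gt0 sax /porbitP[i ->]; exists (i %% a); rewrite ?ltn_mod //.
by rewrite {1}(divn_eq i a) mulnC expgD permM expgM (permX_fix _ sax).
Qed.

Lemma porbit_conj (T : finType) (s w : {perm T}) x :
  porbit (s ^ w) (w x) = w @: porbit s x.
Proof.
apply/setP => z; apply/porbitP/imsetP => [[i ->]|[_ /porbitP[i ->] ->]].
  by exists ((s ^+ i) x); rewrite ?mem_porbit // -conjXg permJ.
by exists i; rewrite -conjXg permJ.
Qed.

(** * The n-cycle, its cuts and their conjugates *)

Definition shift n : 'S_n := perm (@ordS_inj n).

Lemma shiftX n i (z : 'I_n) : (shift n ^+ i) z = (z + i) %% n :> nat.
Proof.
elim: i => [|i IHi]; first by rewrite expg0 perm1 addn0 modn_small.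
by rewrite expgSr permM permE /= IHi addnS -[in LHS]addn1 modnDml addn1.
Qed.

Section Shift.

Variables (n a b : nat) (x y : 'I_n).
Hypotheses (a_gt0 : 0 < a) (b_gt0 : 0 < b) (abn : a + b = n).
Hypotheses (x0 : x = 0%N :> nat) (ya : y = a :> nat).
Local Notation s := (shift n).
Local Notation c := (cut s x y).

Lemma shift_splits : splits s x y a.
Proof.
apply: splits_avoid => // [|i /andP[i_gt0 lt_ia]].
  by apply/val_inj; rewrite /= shiftX x0 ya modn_small; lia.
rewrite -!val_eqE /= shiftX x0 ya modn_small; lia.
Qed.

Lemma shift_splits_sym : splits s y x b.
Proof.
apply: splits_avoid => // [|i /andP[i_gt0 lt_ib]].
  by apply/val_inj; rewrite /= shiftX x0 ya abn modnn.
rewrite -!val_eqE /= shiftX x0 ya modn_small; lia.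
Qed.

Lemma cutX_l i : i < a -> (c ^+ i) x = i :> nat.
Proof.
move=> lt_ia; have [_ _ cx _] := shift_splits; rewrite cx //.
by rewrite shiftX x0 modn_small; lia.
Qed.

Lemma cutX_r i : i < b -> (c ^+ i) y = (a + i)%N :> nat.
Proof.
move=> lt_ib; have [_ _ cy _] := shift_splits_sym.
by rewrite cutC cy // shiftX ya modn_small; lia.
Qed.

Lemma porbit_cut_l : porbit c x = [set z : 'I_n | z < a].
Proof.
have [_ _ _ cax] := shift_splits.
apply/setP=> z; rewrite inE; apply/idP/idP => [|lt_za]; last first.
  by apply/porbitP; exists z; apply/val_inj; rewrite /= cutX_l.
by case/(porbit_period a_gt0 cax) => i lt_ia ->; rewrite cutX_l.
Qed.

Lemma porbit_cut_r : porbit c y = [set z : 'I_n | a <= z].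
Proof.
have [_ _ _ cby] := shift_splits_sym; rewrite cutC in cby.
apply/setP=> z; rewrite inE; apply/idP/idP => [|le_az].
  by case/(porbit_period b_gt0 cby) => i lt_ib ->; rewrite cutX_r ?leq_addr.
apply/porbitP; exists (z - a)%N; apply/val_inj; rewrite /= cutX_r ?subnKC //.
by rewrite ltn_subLR // abn.
Qed.

Lemma card_porbit_cut_l : #|porbit c x| = a.
Proof.
rewrite porbit_cut_l -[RHS](card_ord a).
have le_an : a <= n by lia.
have widen_inj : injective (widen_ord le_an).
  by move=> i j /(congr1 val) /= /val_inj.
rewrite -(card_imset predT widen_inj).
apply: eq_card => z; rewrite inE; apply/idP/imsetP => [lt_za|[i _ ->]] //=.
by exists (Ordinal lt_za) => //; apply/val_inj.
Qed.

Lemma card_porbit_cut_r : #|porbit c y| = b.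
Proof.
have -> : porbit c y = ~: porbit c x.
  by rewrite porbit_cut_l porbit_cut_r; apply/setP => z; rewrite !inE -leqNgt.
apply/eqP; rewrite -(eqn_add2l #|porbit c x|) cardsC card_ord.
by rewrite card_porbit_cut_l abn.
Qed.

(** For [a = b] both orders of the two cycles count, in accordance with the factor 2 in [jet2]. *)
Definition marked_pairs (t : 'S_n) (a b : nat) : {set 'I_n * 'I_n} :=
  [set p | [&& porbit t p.1 != porbit t p.2,
               #|porbit t p.1| == a & #|porbit t p.2| == b]].

(** A conjugator from [c] to [t] is determined by the images of [x] and [y], one point on each cycle
    of [c]. *)
Lemma conj_cut_le (t : 'S_n) :
  #|[set w : 'S_n | c ^ w == t]| <= #|marked_pairs t a b|.
Proof.
pose e (w : 'S_n) := (w x, w y).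
have wE (w : 'S_n) i z : w ((c ^+ i) z) = ((c ^ w) ^+ i) (w z).
  by rewrite -conjXg permJ.
rewrite -(card_in_imset (f := e)); last first.
  move=> w1 w2; rewrite !inE => /eqP cw1 /eqP cw2 [ex ey].
  apply/permP => z; have [lt_za|le_az] := ltnP z a.
    have -> : z = (c ^+ z) x by apply/val_inj; rewrite /= cutX_l.
    by rewrite !wE cw1 cw2 ex.
  have -> : z = (c ^+ (z - a)) y.
    by apply/val_inj; rewrite /= cutX_r ?subnKC // ltn_subLR // abn.
  by rewrite !wE cw1 cw2 ey.
apply/subset_leq_card/subsetP => _ /imsetP[w + ->]; rewrite !inE => /eqP <- /=.
rewrite !porbit_conj !(card_imset _ (@perm_inj _ w)).
rewrite card_porbit_cut_l card_porbit_cut_r !eqxx !andbT.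
rewrite (inj_eq (imset_inj (@perm_inj _ w))) porbit_cut_l porbit_cut_r.
by apply/eqP => /setP/(_ x); rewrite !inE x0 a_gt0 leqNgt a_gt0.
Qed.

End Shift.

(** For an n-cycle [t], each starting point [z] gives a conjugator [i |-> (t ^+ i) z]. *)
Lemma conj_shift_ge n (t : 'S_n) :
  #|porbits t| = 1%N -> n <= #|[set w : 'S_n | shift n ^ w == t]|.
Proof.
move/eqP/cards1P => [C tC].
have orb z : porbit t z = setT.
  have orbC v : porbit t v = C by apply/set1P; rewrite -tC imset_f.
  by apply/setP => v; rewrite inE orbC -(orbC v) porbit_id.
have tn z : (t ^+ n) z = z.
  by rewrite permX -{2}(iter_porbit t z) orb cardsT card_ord.
have f_inj z : injective (fun i : 'I_n => (t ^+ i) z).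
  move=> i j; rewrite !permX => eq_ij.
  have := uniq_traject_porbit t z; rewrite orb cardsT card_ord => tU.
  apply/val_inj/eqP; rewrite -(nth_uniq z _ _ tU) ?size_traject //= ?ltn_ord //.
  by rewrite !nth_traject ?ltn_ord //= eq_ij.
pose w z : 'S_n := perm (f_inj z).
have w_inj : injective w.
  move=> z1 z2 /permP eq_w.
  have n_gt0 : 0 < n by apply: leq_ltn_trans (ltn_ord z1).
  by have := eq_w (Ordinal n_gt0); rewrite !permE /= ?expg0 ?perm1.
rewrite -[leqLHS](card_ord n) -(card_imset predT w_inj).
apply/subset_leq_card/subsetP => _ /imsetP[z _ ->]; rewrite inE.
apply/eqP/permP => v; rewrite -(permKV (w z) v) permJ.
move: ((w z)^-1 v) => i; rewrite !permE /= -permM -expgSr.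
have [lt_in|] := ltnP i.+1 n; first by rewrite modn_small.
move=> le_ni; have -> : i.+1 = n by apply/eqP; rewrite eqn_leq le_ni ltn_ord.
by rewrite modnn expg0 perm1 tn.
Qed.

End CyclicWords.

Local Open Scope ring_scope.

(** * The power sum expansion *)

Section PowerSumExpansion.

Variables (n : nat) (m : 'I_n -> 'I_n).
Hypothesis hm : hessenberg m.

(** The nonzero terms of its Leibniz expansion come from the permutations [s] with [s i <= m i] that
    preserve the coloring. *)
Definition color_matrix (C : eqType) (kappa : 'I_n -> C) : 'M[int]_n :=
  \matrix_(i, j) ((j <= m i)%N && (kappa i == kappa j))%:R.

(** A proper coloring gives a triangular matrix with unit diagonal, any other one two equal
    columns. *)
Lemma det_color_matrix (C : eqType) (kappa : 'I_n -> C) :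
  \det (color_matrix kappa) = (proper_coloring m kappa)%:R.
Proof.
have [m_mono m_ge] := hm.
have [/forallP proper|] := boolP (proper_coloring m kappa).
  rewrite det_trig; last first.
    apply/is_trig_mxP => i j lt_ij; rewrite mxE.
    have /forallP/(_ j)/implyP adj := proper i.
    have [le_j /=|//] := boolP (j <= m i)%N.
    by rewrite (negbTE (adj _)) // /hess_adj lt_ij le_j.
  by rewrite big1 // => i _; rewrite mxE m_ge eqxx.
(* The columns i and j are equal, where i is the least vertex with a larger
   neighbor of its color and j is the next vertex of the same color. *)
case/forallPn => u /forallPn[v]; rewrite negb_imply negbK => /andP[adj_uv eq_uv].
pose mono (i j : 'I_n) := [&& i < j, j <= m i & kappa i == kappa j]%N.
have [i0 [j0 ij0]] : exists i j, mono i j.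
  case/orP: adj_uv => /andP[lt le]; first by exists u, v; apply/and3P.
  by exists v, u; apply/and3P; rewrite eq_sym.
pose clash i := [exists j, mono i j].
have ex_i : clash i0 by apply/existsP; exists j0.
case: (arg_minnP (fun i : 'I_n => nat_of_ord i) ex_i) => i {i0 j0 ij0 ex_i}.
case/existsP=> j0 /and3P[lt_ij0 le_j0 /eqP eq_ij0] min_i.
pose later (j : 'I_n) := (i < j)%N && (kappa i == kappa j).
have ex_j : later j0 by rewrite /later lt_ij0 eq_ij0 eqxx.
case: (arg_minnP (fun i : 'I_n => nat_of_ord i) ex_j) => j.
case/andP=> lt_ij /eqP eq_ij min_j.
have le_jm : (j <= m i)%N by apply: leq_trans (min_j _ ex_j) le_j0.
rewrite -det_tr; apply: (determinant_alternate (i1 := i) (i2 := j)).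
  by rewrite neq_ltn lt_ij.
move=> x; rewrite !mxE -eq_ij.
have [eq_xi|] := eqVneq (kappa x) (kappa i); last by rewrite !andbF.
rewrite !andbT; congr (nat_of_bool _)%:R.
(* In rows of this color, both entries vanish above row [i], by the choice of [i]. From row [i] on
   both are 1: [j <= m i], and [j <= x <= m x] for [x > i]. *)
have [lt_xi|le_ix] := ltnP x i.
  have Nxi : ~~ (i <= m x)%N.
    apply/negP => le_im; have /min_i : clash x.
      by apply/existsP; exists i; rewrite /mono lt_xi le_im eq_xi eqxx.
    by rewrite leqNgt lt_xi.
  rewrite (negbTE Nxi); apply/esym/negbTE; apply: contra Nxi.
  exact: leq_trans (ltnW lt_ij).
rewrite (leq_trans le_ix (m_ge x)); apply/esym.
move: le_ix; rewrite leq_eqVlt => /orP[/eqP/val_inj <- //|lt_ix].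
by apply: leq_trans (min_j x _) (m_ge x); rewrite /later lt_ix eq_xi eqxx.
Qed.

Lemma csf_sum_perm k :
  csf m k = \sum_(s : 'S_n | [forall i, s i <= m i]%N) (-1) ^+ s *:
    \sum_(kappa : {ffun 'I_n -> 'I_k} | [forall i, kappa (s i) == kappa i])
       \prod_(v < n) 'X_(kappa v).
Proof.
under eq_bigr do rewrite scaler_sumr.
rewrite (exchange_big_dep predT) //= /csf big_mkcond /=; apply: eq_bigr => kappa _.
transitivity ((proper_coloring m kappa)%:R *:
    \prod_(v < n) ('X_(kappa v) : {mpoly int[k]})).
  by case: ifP => _; rewrite ?scale1r ?scale0r.
rewrite -det_color_matrix scaler_suml /= [RHS]big_mkcond /=; apply: eq_bigr => s _.
have -> : \prod_i color_matrix kappa i (s i) =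
    ([forall i, s i <= m i]%N && [forall i, kappa (s i) == kappa i])%:R.
  have [/andP[/forallP le_s /forallP eq_s]|] := boolP (_ && _).
    by rewrite big1 // => i _; rewrite mxE le_s eq_sym eq_s.
  rewrite negb_and => /orP[] /forallPn[i Ni]; apply/eqP/prodf_eq0; exists i => //.
    by rewrite mxE (negbTE Ni).
  by rewrite mxE [kappa i == _]eq_sym (negbTE Ni) andbF.
by case: (_ && _); rewrite ?mulr1 ?mulr0 ?scale0r.
Qed.

End PowerSumExpansion.

(** A coloring fixed by [s] amounts to one color per cycle; [i0] is the default that distributivity
    requires outside [porbits s]. *)
Lemma fixed_coloring_sum n k (s : 'S_n) (i0 : 'I_k) :
  \sum_(kappa : {ffun 'I_n -> 'I_k} | [forall i, kappa (s i) == kappa i])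
     \prod_(v < n) ('X_(kappa v) : {mpoly int[k]}) =
  \prod_(C in porbits s) \sum_(i < k) 'X_i ^+ #|C|.
Proof.
rewrite (big_distr_big i0) /=.
pose down (f : {ffun {set 'I_n} -> 'I_k}) := [ffun v => f (porbit s v)].
pose up (kappa : {ffun 'I_n -> 'I_k}) := [ffun C : {set 'I_n} =>
  if C \in porbits s then odflt i0 (omap kappa [pick v in C]) else i0].
have up_porbit (kappa : {ffun 'I_n -> 'I_k}) v :
    (forall u, u \in porbit s v -> kappa u = kappa v) ->
    up kappa (porbit s v) = kappa v.
  move=> kappa_v; rewrite ffunE imset_f //.
  by case: pickP => [u /kappa_v //|/(_ v)]; rewrite porbit_id.
rewrite (reindex_onto down up) /=; last first.
  move=> kappa /forallP kappa_s; apply/ffunP => v; rewrite ffunE up_porbit //.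
  move=> _ /porbitP[i ->]; elim: i => [|i IHi]; first by rewrite expg0 perm1.
  by rewrite expgSr permM (eqP (kappa_s _)) IHi.
apply: eq_big => [f|f _].
  have down_s : [forall i, down f (s i) == down f i].
    by apply/forallP => i; rewrite !ffunE (porbit_perm s 1).
  rewrite down_s; apply/eqP/pffun_onP => [eq_f|[f_supp _]].
    split=> //; apply/subsetP => C; rewrite inE -eq_f ffunE.
    by case: ifP => //; rewrite eqxx.
  apply/ffunP => C; have [/imsetP[v _ ->]|NC] := boolP (C \in porbits s).
    rewrite up_porbit ?ffunE // => u; rewrite -eq_porbit_mem !ffunE.
    by move=> /eqP->.
  rewrite ffunE (negbTE NC); apply/esym/eqP; apply: contraR NC.
  exact: (subsetP f_supp C).
rewrite (partition_big (porbit s) (mem (porbits s))) /=; last first.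
  by move=> v _; apply: imset_f.
apply: eq_bigr => C /imsetP[v _ ->].
rewrite (eq_bigr (fun=> 'X_(f (porbit s v)))) => [|u /eqP eq_uv]; last first.
  by rewrite ffunE eq_uv.
rewrite prodr_const; congr (_ ^+ _); apply: eq_card => u.
by rewrite -eq_porbit_mem.
Qed.

(** * Newton's identities *)

Section Hooks.

Variable n : nat.
Local Notation P := {mpoly int[n]}.
Implicit Types (h : {set 'I_n}) (i j k t : nat).

Definition power_sum i : P := \sum_(v < n) 'X_v ^+ i.

(** For [i >= 2] this is the monomial symmetric function of the hook (i, 1^t); for [i = 1] each
    monomial of e_(t+1) occurs t+1 times. *)
Definition hook_out i t : P :=
  \sum_(h : {set 'I_n} | #|h| == t) \sum_(v | v \notin h)
    'X_v ^+ i * \prod_(u in h) 'X_u.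

Lemma hook_out0 i : hook_out i 0 = power_sum i.
Proof.
rewrite /hook_out (eq_bigl (pred1 set0)); last by move=> h; rewrite /= cards_eq0.
rewrite big_pred1_eq; apply: eq_big => [v|v _]; first by rewrite inE.
by rewrite big_set0 mulr1.
Qed.

Lemma hook_in i t :
  \sum_(h : {set 'I_n} | #|h| == t.+1) \sum_(v in h)
    'X_v ^+ i * \prod_(u in h) 'X_u = hook_out i.+1 t :> P.
Proof.
rewrite /hook_out !pair_big_dep /=.
pose add (p : {set 'I_n} * 'I_n) := (p.2 |: p.1, p.2).
pose del (p : {set 'I_n} * 'I_n) := (p.1 :\ p.2, p.2).
rewrite (reindex_onto add del) /=; last first.
  by case=> h v /andP[_ /= vh]; rewrite /add /del /= setD1K.
apply: eq_big => [[h v]|[h v]]; rewrite /add /del /= xpair_eqE eqxx andbT.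
  rewrite setU11 andbT; have [vh|vh] := boolP (v \in h).
    rewrite andbF; apply/andP => -[_ /eqP hE].
    by move: vh; rewrite -hE !inE eqxx.
  by rewrite setU1K // eqxx !andbT cardsU1 vh.
case/andP=> _ /eqP hE.
have vh : v \notin h by rewrite -hE !inE eqxx.
by rewrite big_setU1 //= mulrA -exprSr.
Qed.

Lemma hook_out1 t : hook_out 1 t = mesym n int t.+1 *+ t.+1.
Proof.
rewrite -hook_in /mesym -sumrMnl; apply: eq_bigr => h /eqP <-.
transitivity (\sum_(v in h) \prod_(u in h) ('X_u : P)); last by rewrite sumr_const.
by apply: eq_bigr => v _; rewrite expr0 mul1r.
Qed.

(** In [power_sum i] times e_(t+1), the variable of the power lies outside the set [h], or inside it
    and is absorbed by [hook_in]. *)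
Lemma hook_outS i t :
  hook_out i.+1 t = power_sum i * mesym n int t.+1 - hook_out i t.+1.
Proof.
apply/eqP; rewrite eq_sym subr_eq -hook_in; apply/eqP.
rewrite /hook_out /power_sum /mesym mulr_sumr -big_split /=; apply: eq_bigr => h _.
by rewrite mulr_suml (bigID (mem h)).
Qed.

(* The variable standing for e_k if 0 < k <= n, and 0 otherwise. *)
Definition evar k : P := \sum_(i < n | i.+1 == k) 'X_i.

Definition esyms : n.-tuple P := [tuple mesym n int i.+1 | i < n].

Lemma evar_comp k : evar k.+1 \mPo esyms = mesym n int k.+1.
Proof.
rewrite raddf_sum /=; have [lt_kn|le_nk] := ltnP k n.
  rewrite (big_pred1 (Ordinal lt_kn)) => [|i]; last by rewrite /= eqSS.
  by rewrite comp_mpolyXU -tnth_nth tnth_mktuple.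
rewrite mesym_geqnE // big_pred0 // => i.
by apply/negbTE; rewrite eqSS neq_ltn (leq_trans (ltn_ord i)).
Qed.

(** This expresses [hook_out i.+1 t] through the e_j, following [hook_outS]; so [newton i 0] stands
    for the power sum of exponent i+1. *)
Fixpoint newton i t : P :=
  if i is i'.+1 then newton i' 0 * evar t.+1 - newton i' t.+1
  else evar t.+1 *+ t.+1.

Lemma newton_comp i t : newton i t \mPo esyms = hook_out i.+1 t.
Proof.
elim: i t => [|i IHi] t /=; first by rewrite comp_mpolyMn evar_comp hook_out1.
by rewrite comp_mpolyB rmorphM /= !IHi evar_comp [RHS]hook_outS -hook_out0.
Qed.

(* Taylor coefficients at the origin, except that jet2 u u is twice the
   coefficient of 'X_u ^+ 2; this makes the case a = b uniform with a <> b. *)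
Definition jet0 (p : P) : int := p@_0%MM.
Definition jet1 (u : 'I_n) (p : P) : int := jet0 p^`M(u).
Definition jet2 (u v : 'I_n) (p : P) : int := jet0 p^`M(u)^`M(v).

Lemma jet0M p q : jet0 (p * q) = jet0 p * jet0 q.
Proof. exact: rmorphM. Qed.

Lemma jet0B p q : jet0 (p - q) = jet0 p - jet0 q.
Proof. exact: raddfB. Qed.

Lemma jet0D p q : jet0 (p + q) = jet0 p + jet0 q.
Proof. exact: raddfD. Qed.

Lemma jet1M u p q : jet1 u (p * q) = jet1 u p * jet0 q + jet0 p * jet1 u q.
Proof. by rewrite /jet1 mderivM jet0D !jet0M. Qed.

Lemma jet1B u p q : jet1 u (p - q) = jet1 u p - jet1 u q.
Proof. by rewrite /jet1 mderivB jet0B. Qed.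

Lemma jet2B u v p q : jet2 u v (p - q) = jet2 u v p - jet2 u v q.
Proof. by rewrite /jet2 !mderivB jet0B. Qed.

Lemma jet2M u v p q : jet2 u v (p * q) =
  jet2 u v p * jet0 q + jet1 u p * jet1 v q
  + (jet1 v p * jet1 u q + jet0 p * jet2 u v q).
Proof. by rewrite /jet2 /jet1 mderivM mderivD !mderivM !jet0D !jet0M. Qed.

Lemma jet0_evar k : jet0 (evar k) = 0.
Proof.
rewrite /jet0 raddf_sum big1 // => i _.
by rewrite /= mcoeffX mnm1_eq0.
Qed.

Lemma mderiv_evar u k : (evar k)^`M(u) = (u.+1 == k)%:R.
Proof.
rewrite raddf_sum /=.
transitivity (\sum_(i < n | i.+1 == k) ((i == u)%:R : P)).
  apply: eq_bigr => i _; rewrite mderivX mnm1E.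
  case: eqVneq => [->|_]; last by rewrite scale0r.
  have -> : (U_(u) - U_(u) = 0 :> 'X_{1..n})%MM.
    by apply/mnmP=> z; rewrite mnmBE mnm0E subnn.
  by rewrite mpolyX0 scale1r.
have [uk|uk] := eqVneq u.+1 k.
  rewrite (bigD1 u) ?uk //= eqxx big1 ?addr0 // => i /andP[_].
  by move/negbTE->.
rewrite big1 // => i /eqP ik; case: eqVneq => // iu.
by rewrite -ik iu eqxx in uk.
Qed.

Lemma jet1_evar u k : jet1 u (evar k) = (u.+1 == k)%:R.
Proof. by rewrite /jet1 mderiv_evar; apply: (rmorph_nat (mcoeff 0%MM)). Qed.

Lemma jet2_evar u v k : jet2 u v (evar k) = 0.
Proof.
by rewrite /jet2 mderiv_evar -[_%:R]mpolyC_nat mderivC /jet0 mcoeff0.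
Qed.

Lemma jet0_newton i t : jet0 (newton i t) = 0.
Proof.
elim: i t => [|i IHi] t /=; last by rewrite jet0B jet0M !IHi mul0r subrr.
by rewrite /jet0 mcoeffMn -/(jet0 _) jet0_evar mul0rn.
Qed.

(** Up to products, the recursion trades [i] for [t] with a sign, ending at (i+t+1) e_(i+t+1). *)
Lemma jet1_newton u i t :
  jet1 u (newton i t) =
  (-1) ^+ i * (if u == (i + t)%N :> nat then (i + t).+1%:R else 0).
Proof.
elim: i t => [|i IHi] t /=.
  rewrite /jet1 mderivMn /jet0 mcoeffMn -/(jet0 _) -/(jet1 _ _) jet1_evar.
  by rewrite expr0 mul1r add0n eqSS; case: eqP => _; rewrite ?mul0rn.
rewrite jet1B jet1M !jet0_newton jet0_evar mulr0 mul0r addr0 sub0r IHi.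
by rewrite exprS mulN1r mulNr addnS addSn.
Qed.

(** The product in the recursion contributes only when [t] equals [u] or [v]. As [t] grows by one
    per unfolding, the indicators tell whether this is still to come. At [t = 0] the sum is
    u+v+2. *)
Lemma jet2_newton (u v : 'I_n) i t : ((u + v).+1 = i + t)%N ->
  jet2 u v (newton i t) =
  (-1) ^+ i.+1 * ((u.+1 * (t <= v) + v.+1 * (t <= u))%N%:R).
Proof.
elim: i t => [|i IHi] t uvE /=.
  rewrite /jet2 !mderivMn /jet0 mcoeffMn -/(jet0 _) -/(jet2 _ _ _) jet2_evar.
  rewrite add0n in uvE; have [Nv Nu] : (t <= v)%N = false /\ (t <= u)%N = false.
    by rewrite -uvE ltnNge leq_addl ltnNge leq_addr.
  by rewrite mul0rn Nv Nu !muln0 mulr0.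
rewrite jet2B IHi; last by rewrite uvE addnS.
rewrite jet2M !jet1_newton !jet1_evar jet0_newton jet0_evar mulr0 mul0r !eqSS !addn0.
have leq_split w : ((t <= w) = (w == t) + (t < w) :> nat)%N.
  by rewrite leq_eqVlt eq_sym; case: ltngtP.
rewrite (leq_split v) (leq_split u).
have -> : (v == t :> nat) = (u == i :> nat).
  by apply/eqP/eqP => e; move: uvE; rewrite e; clear; lia.
have -> : (u == t :> nat) = (v == i :> nat).
  by apply/eqP/eqP => e; move: uvE; rewrite e; clear; lia.
rewrite !exprS.
case: eqP => [<-|_]; case: eqP => [<-|_]; rewrite !natrD !natrM; ring.
Qed.

End Hooks.

(** * The coefficient of two-part partitions *)

Section Jets.

Variables (n : nat) (u v : 'I_n).
Local Notation P := {mpoly int[n]}.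

Lemma jet2_sumZ (I : Type) (r : seq I) (Q : pred I) (k : I -> int) (F : I -> P) :
  jet2 u v (\sum_(i <- r | Q i) k i *: F i) =
  \sum_(i <- r | Q i) k i * jet2 u v (F i).
Proof.
rewrite /jet2 (raddf_sum (mderiv u)) (raddf_sum (mderiv v)) /jet0 raddf_sum.
by apply: eq_bigr => i _; rewrite /= !mderivZ mcoeffZ.
Qed.

Lemma jet1M0 (p q : P) : jet0 p = 0 -> jet0 q = 0 -> jet1 u (p * q) = 0.
Proof. by move=> p0 q0; rewrite jet1M p0 q0 mulr0 mul0r addr0. Qed.

Lemma jet2_1 : jet2 u v 1 = 0.
Proof. by rewrite /jet2 -mpolyC1 !mderivC /jet0 mcoeff0. Qed.

End Jets.

Lemma jet2M0 n (u v : 'I_n) (p q : {mpoly int[n]}) : jet0 p = 0 -> jet0 q = 0 ->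
  jet2 u v (p * q) = jet1 u p * jet1 v q + jet1 v p * jet1 u q.
Proof. by move=> p0 q0; rewrite jet2M p0 q0 mulr0 mul0r add0r addr0. Qed.

Lemma jet2_prod3 n (u v : 'I_n) (p q r : {mpoly int[n]}) :
  jet0 p = 0 -> jet0 q = 0 -> jet0 r = 0 -> jet2 u v (p * (q * r)) = 0.
Proof.
move=> p0 q0 r0; have qr0 : jet0 (q * r) = 0 by rewrite jet0M q0 mul0r.
by rewrite jet2M0 // !jet1M0 // !mulr0 addr0.
Qed.

Section Coefficient.

Variables (n : nat) (u v : 'I_n).
Hypothesis uv : (u + v).+2 = n.
Local Notation a := u.+1.
Local Notation b := v.+1.
Local Notation P := {mpoly int[n]}.

(** Only products of two variables survive [jet2], and since parts are sorted only [[:: a; b]]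
    matches, twice if [a = b]. *)
Lemma jet2_expansion (c : seq nat -> int) : (b <= a)%N ->
  jet2 u v (\sum_(la <- partitions n) c la *: \prod_(j <- la) evar n j) =
  c [:: a; b] * (1 + (u == v)%:R).
Proof.
move=> le_ba; rewrite jet2_sumZ.
rewrite (bigD1_seq [:: a; b]) ?partitions_uniq //=; last first.
  rewrite mem_partitions /is_partition /= andbT le_ba /=.
  by rewrite addn0 addSn addnS uv eqxx.
rewrite [X in _ + X]big_seq_cond [X in _ + X]big1 ?addr0 => [|la].
  rewrite !big_cons big_nil mulr1 jet2M0 ?jet0_evar // !jet1_evar !eqxx mulr1.
  rewrite !eqSS !val_eqE [v == u]eq_sym.
  by case: (u == v); rewrite ?mulr1 ?mulr0.
rewrite mem_partitions => /andP[/and3P[la_sorted _ _] la_ab].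
case: la la_sorted la_ab => [|x [|y [|z la]]] la_sorted la_ab.
- by rewrite big_nil jet2_1 mulr0.
- by rewrite big_cons big_nil mulr1 jet2_evar mulr0.
- rewrite !big_cons big_nil mulr1 jet2M0 ?jet0_evar // !jet1_evar.
  have le_yx : (y <= x)%N by case/andP: la_sorted.
  have -> : (a == x)%:R * (b == y)%:R = 0 :> int.
    rewrite -natrM mulnb; case: (a =P x) la_ab => [<-|_] //.
    by case: (b =P y) => [<-|_] //; rewrite eqxx.
  suff -> : (b == x)%:R * (a == y)%:R = 0 :> int by rewrite addr0 mulr0.
  rewrite -natrM mulnb; case: (b =P x) la_ab le_yx => [<-|_] //.
  case: (a =P y) => [<-|_] // la_ab le_ab.
  have eq_ab : a = b by apply/eqP; rewrite eqn_leq le_ab.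
  by rewrite eq_ab eqxx in la_ab.
rewrite !big_cons jet2_prod3 ?mulr0 // ?jet0_evar // jet0M jet0_evar.
by rewrite mul0r.
Qed.

Lemma jet2_prod_orbits (A : {set {set 'I_n}}) (F : {set 'I_n} -> P) :
  (forall C, jet0 (F C) = 0) -> (#|A| != 1)%N -> (#|A| != 2)%N ->
  jet2 u v (\prod_(C in A) F C) = 0.
Proof.
move=> F0 A1 A2; have [->|/set0Pn[C CA]] := eqVneq A set0.
  by rewrite big_set0 jet2_1.
have := cardsD1 C A; rewrite CA => cA.
have [/eqP|/set0Pn[D DA]] := eqVneq (A :\ C) set0.
  by rewrite -cards_eq0 => /eqP c0; rewrite cA c0 in A1.
have := cardsD1 D (A :\ C); rewrite DA => cAD.
have [/eqP|/set0Pn[E EA]] := eqVneq (A :\ C :\ D) set0.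
  by rewrite -cards_eq0 => /eqP c0; rewrite cA cAD c0 in A2.
rewrite (big_setD1 C) // (big_setD1 D) //= jet2_prod3 //.
by rewrite (big_setD1 E) //= jet0M F0 mul0r.
Qed.

Lemma marked_pairs_porbits (s : 'S_n) :
  marked_pairs s a b != set0 -> #|porbits s| = 2%N.
Proof.
case/set0Pn => -[x y]; rewrite inE /= => /and3P[Nxy /eqP cx /eqP cy].
have -> : porbits s = [set porbit s x; porbit s y].
  apply/setP => C; rewrite !inE; apply/imsetP/idP => [[z _ ->]|]; last first.
    by case/orP=> /eqP ->; [exists x|exists y].
  have : z \in porbit s x :|: porbit s y.
    suff -> : porbit s x :|: porbit s y = setT by rewrite inE.
    apply/eqP; rewrite eqEcard subsetT cardsT card_ord cardsU cx cy.
    have -> : porbit s x :&: porbit s y = set0.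
      apply/setP => w; rewrite !inE; apply/negbTE/negP => /andP[].
      rewrite -!eq_porbit_mem => /eqP wx /eqP wy.
      by rewrite -wx wy eqxx in Nxy.
    by rewrite cards0 subn0 addSn addnS uv /=.
  by rewrite inE -!eq_porbit_mem.
by rewrite cards2 Nxy.
Qed.

(** A single cycle contributes -n, as the signs of [s] and of [jet2_newton] are opposite. Two cycles
    contribute products of linear terms, which bound the marked pairs; all other permutations
    contribute 0. *)
Lemma marked_pairs_le (s : 'S_n) :
  #|marked_pairs s a b|%:R - (n * (#|porbits s| == 1)%N)%:R <=
  (-1) ^+ s * jet2 u v (\prod_(C in porbits s) newton n #|C|.-1 0) :> int.
Proof.
have sgn_s : (-1) ^+ s = (-1) ^+ n * (-1) ^+ #|porbits s| :> int.
  by rewrite /odd_perm signr_addb !signr_odd card_ord.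
have Z0 : #|porbits s| != 2%N -> #|marked_pairs s a b| = 0%N.
  have [->|Zs] := eqVneq (marked_pairs s a b) set0; first by rewrite cards0.
  by rewrite marked_pairs_porbits.
have [c1|N1] := eqVneq #|porbits s| 1%N.
  rewrite Z0 ?c1 // sub0r muln1 sgn_s c1.
  have /cards1P[C sC] : #|porbits s| == 1%N by apply/eqP.
  have CT : C = setT.
    apply/setP => z; have /set1P <- : porbit s z \in [set C] by rewrite -sC imset_f.
    by rewrite porbit_id inE.
  rewrite sC big_set1 CT cardsT card_ord jet2_newton; last first.
    by rewrite addn0; apply: (congr1 predn uv).
  rewrite !leq0n !muln1 prednK; last by apply: leq_ltn_trans (ltn_ord u).
  have -> : (a + b = n)%N by rewrite addSn addnS uv.
  by rewrite expr1 mulrACA -expr2 sqrr_sign mul1r mulN1r.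
rewrite muln0 subr0.
have [c2|N2] := eqVneq #|porbits s| 2%N; last first.
  rewrite jet2_prod_orbits ?mulr0 // => [|C]; last exact: jet0_newton.
  have [->|/marked_pairs_porbits c2] := eqVneq (marked_pairs s a b) set0.
    by rewrite cards0.
  by rewrite c2 in N2.
rewrite sgn_s c2.
have /cards2P[C [D [NCD sCD]]] : #|porbits s| == 2%N by apply/eqP.
rewrite sCD big_setU1 ?inE //= big_set1 jet2M0 ?jet0_newton // !jet1_newton !addn0.
have card_gt0 E : E \in porbits s -> (0 < #|E|)%N.
  by case/imsetP=> z _ ->; rewrite lt0n card_porbit_neq0.
have C_gt0 : (0 < #|C|)%N by rewrite card_gt0 // sCD set21.
have D_gt0 : (0 < #|D|)%N by rewrite card_gt0 // sCD set22.
have jetE (w : 'I_n) (d : nat) : (0 < d)%N ->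
    (-1) ^+ d.-1 * (if w == d.-1 :> nat then d.-1.+1%:R else 0) =
    (-1) ^+ w * (d * (d == w.+1))%N%:R :> int.
  case: d => // d _ /=; rewrite eqSS eq_sym.
  by case: eqP => [->|_]; rewrite ?muln1 // muln0 !mulr0.
rewrite !jetE //.
have sgn_uv : (-1) ^+ n = (-1) ^+ u * (-1) ^+ v :> int.
  by rewrite -(congr1 (GRing.exp (-1)) uv) !exprS !mulN1r opprK exprD.
have sgn2 k : (-1) ^+ k * (-1) ^+ k = 1 :> int by rewrite -expr2 sqrr_sign.
(* Marked pairs lie in C x D or D x C, depending on the sizes; the two boxes match the two terms of
   [jet2M0]. *)
pose box (E F : {set 'I_n}) :=
  if (#|E| == a) && (#|F| == b) then setX E F else set0.
have boxE (E F : {set 'I_n}) :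
    (#|box E F| = #|E| * (#|E| == a) * (#|F| * (#|F| == b)))%N.
  rewrite /box; case: (#|E| == a); case: (#|F| == b); rewrite /= ?cards0 ?muln0 //.
  by rewrite cardsX !muln1.
have sub_box : marked_pairs s a b \subset box C D :|: box D C.
  apply/subsetP => -[x y]; rewrite inE /= => /and3P[Nxy cx cy].
  have orb z : (porbit s z == C) || (porbit s z == D).
    by rewrite -in_set2 -sCD imset_f.
  rewrite inE /box.
  case/orP: (orb x) (orb y) Nxy cx cy (porbit_id s x) (porbit_id s y) =>
    /eqP->; case/orP=> /eqP->; rewrite ?eqxx // => _ -> -> xC yD; rewrite inE xC yD //.
  by rewrite orbT.
apply: (@le_trans _ _ (#|box C D| + #|box D C|)%N%:R).
  by rewrite ler_nat (leq_trans (subset_leq_card sub_box)) // cardsU leq_subr.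
rewrite sgn_uv !boxE natrD !natrM.
move: (sgn2 u) (sgn2 v); set eu := (-1) ^+ u; set ev := (-1) ^+ v => eu2 ev2.
rewrite le_eqVlt; apply/orP; left; apply/eqP.
set c1 := #|C|%:R; set d1 := #|D|%:R.
set ca := (#|C| == a)%:R; set cb := (#|C| == b)%:R.
set da := (#|D| == a)%:R; set db := (#|D| == b)%:R.
transitivity ((eu * eu) * (ev * ev) * (c1 * ca * (d1 * db) + d1 * da * (c1 * cb))).
  by rewrite eu2 ev2 !mul1r.
by ring.
Qed.

End Coefficient.

Lemma csf_newton n (m : 'I_n -> 'I_n) : hessenberg m -> (0 < n)%N ->
  (\sum_(s : 'S_n | [forall i, s i <= m i]%N)
     (-1) ^+ s *: \prod_(C in porbits s) newton n #|C|.-1 0) \mPo esyms n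
  = csf m n.
Proof.
move=> hm n_gt0; rewrite csf_sum_perm // raddf_sum; apply: eq_bigr => s _.
rewrite /= comp_mpolyZ (fixed_coloring_sum s (Ordinal n_gt0)) rmorph_prod /=.
congr (_ *: _); apply: eq_bigr => C /imsetP[z _ ->].
by rewrite newton_comp hook_out0 prednK // lt0n card_porbit_neq0.
Qed.

Lemma expansion_evar n (m : 'I_n -> 'I_n) c : e_expansion n (csf m) c ->
  (\sum_(la <- partitions n) c la *: \prod_(j <- la) evar n j) \mPo esyms n
  = csf m n.
Proof.
move=> ->; rewrite raddf_sum; apply: eq_big_seq => la.
rewrite mem_partitions => /and3P[_ la0 _].
rewrite /= comp_mpolyZ rmorph_prod /elem_prod; congr (_ *: _).
apply: eq_big_seq => -[|j] j_la; first by rewrite j_la in la0.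
exact: evar_comp.
Qed.

(** [s ^ w] sends [w i] to [w (s i)], so admissibility of [w] is a condition on this conjugate
    alone. *)
Lemma card_adm_sum n (m : 'I_n -> 'I_n) (s : 'S_n) :
  #|[set w : 'S_n | adm m s w]| =
  (\sum_(t : 'S_n | [forall i, t i <= m i]) #|[set w : 'S_n | s ^ w == t]%g|)%N.
Proof.
rewrite -sum1_card (partition_big (fun w => s ^ w)%g
  (fun t : 'S_n => [forall i, t i <= m i]%N)) /=.
  apply: eq_bigr => t le_t; rewrite -sum1_card; apply: eq_bigl => w; rewrite !inE.
  case: eqP => [wt|]; last by rewrite andbF.
  rewrite andbT; apply/forallP => i.
  by rewrite -permJ wt; apply: (forallP le_t).
move=> w; rewrite inE => /forallP sw; apply/forallP => i.
by have := sw ((w^-1)%g i); rewrite -permJ permKV.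
Qed.

Theorem corollary1p10 (n : nat) (m : 'I_n -> 'I_n) (a b : nat)
    (c : seq nat -> int) :
  (2 <= n)%N ->
  hessenberg m ->
  (b <= a)%N -> (1 <= b)%N -> (a + b)%N = n ->
  e_expansion n (csf m) c ->
  0 <= c [:: a; b].
Proof.
move=> n_ge2 hm le_ba b_gt0 abn expand.
have n_gt0 : (0 < n)%N by apply: ltnW.
have a_gt0 : (0 < a)%N by apply: leq_trans le_ba.
have lt_u : (a.-1 < n)%N by lia.
have lt_v : (b.-1 < n)%N by lia.
have lt_a : (a < n)%N by lia.
pose u := Ordinal lt_u; pose v := Ordinal lt_v.
have ua : u.+1 = a by rewrite /= prednK.
have vb : v.+1 = b by rewrite /= prednK.
have uv : (u + v).+2 = n by rewrite /=; lia.
have := etrans (expansion_evar expand) (esym (csf_newton hm n_gt0)).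
(* In n variables e_1, ..., e_n are algebraically independent, so the two polynomials agree before
   substitution. *)
move/msym_fundamental_un/(congr1 (jet2 u v)).
rewrite (jet2_expansion uv) ?ua ?vb // jet2_sumZ => cE.
suff : 0 <= c [:: a; b] * (1 + (u == v)%:R).
  by rewrite pmulr_lge0 //; case: (u == v).
rewrite cE.
pose x := Ordinal n_gt0; pose y := Ordinal lt_a.
have := card_adm_le_cut hm.1
  (shift_splits a_gt0 b_gt0 abn (x := x) (y := y) erefl erefl)
  (shift_splits_sym a_gt0 b_gt0 abn (x := x) (y := y) erefl erefl).
rewrite !card_adm_sum -(ler_nat int) -subr_ge0 => /le_trans; apply.
(* The difference of the two counts and the coefficient are sums over the same permutations,
   compared term by term. *)
rewrite !natr_sum -sumrB; apply: ler_sum => s _.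
apply: le_trans (marked_pairs_le uv s); rewrite ua vb; apply: lerB; rewrite ler_nat.
  exact: conj_cut_le.
case: eqP => [/conj_shift_ge|_]; first by rewrite muln1.
by rewrite muln0.
Qed.
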